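(* Let $k$ be a positive integer. Let $X_1,X_2,\dots$ be independent, identically distributed random variables taking values in the positive integers, let $X$ denote a random variable with their common distribution, and assume $\gcd(\operatorname{Supp} X)=1$. Let $W_n=X_1+\dots+X_n$ for $n\ge 1$ (so, with $W_0=0$, the gaps $W_n-W_{n-1}=X_n$ are i.i.d.). If $\mathbb{E}[X]<k$ (in particular finite), then with probability $1$ the sequence $\{W_n\}_{n\ge1}$ is weakly asymptotically $k$-complete.
   Context: $\operatorname{Supp}X=\{x\in\mathbb{N}: P(X=x)>0\}$. An increasing sequence $\bar w=\{w_n\}_{n\ge1}$ of positive integers is called weakly asymptotically $k$-complete if every sufficiently large integer can be written as the sum of exactly $k$, not necessarily distinct, elements of $\bar w$; i.e. there is $N$ such that every integer $m\ge N$ equals $w_{i_1}+\dots+w_{i_k}$ for some indices $i_1,\dots,i_k$ (repetitions allowed). (The threshold $N$ may depend on the realization of the sequence.) *)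

(* Defs.v *)
From HB Require Import structures.
From mathcomp Require Import all_boot all_order all_algebra.
From mathcomp Require Import all_classical all_reals all_analysis.

Set Implicit Arguments.
Unset Strict Implicit.
Unset Printing Implicit Defensive.

Import Order.TTheory GRing.Theory Num.Theory.

Local Open Scope classical_set_scope.
Local Open Scope ring_scope.
Local Open Scope ereal_scope.

(* The common divisor condition is stated for arbitrary, possibly infinite, S;
   the gcd is the greatest one for divisibility. *)
Definition is_gcd_of (S : set nat) (g : nat) : Prop :=
  (forall x, S x -> (g %| x)%N) /\
  (forall e, (forall x, S x -> (e %| x)%N) -> (e %| g)%N).

Definition Supp (d : measure_display) (T : measurableType d) (R : realType)
    (P : probability T R) (X : {RV P >-> nat}) : set nat :=
  [set x | 0 < P [set w | X w = x]].

(* Product rule over every finite family of distinct indices. *)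
Definition mutually_independent (d d' : measure_display)
    (T : measurableType d) (T' : measurableType d') (R : realType)
    (P : probability T R) (X : nat -> {RV P >-> T'}) : Prop :=
  forall (J : seq nat) (B : nat -> set T'), uniq J ->
    (forall i, measurable (B i)) ->
    P [set w | forall i, i \in J -> B i (X i w)]
      = \prod_(i <- J) P [set w | B i (X i w)].

Definition identically_distributed (d d' : measure_display)
    (T : measurableType d) (T' : measurableType d') (R : realType)
    (P : probability T R) (X : nat -> {RV P >-> T'}) : Prop :=
  forall (i j : nat) (B : set T'), measurable B ->
    distribution P (X i) B = distribution P (X j) B.

(* A sequence {w_n}_{n >= 1} is encoded by w : nat -> nat; the value w 0 is
   irrelevant. *)
Definition weakly_asymptotically_complete (k : nat) (w : nat -> nat) : Prop :=
  [/\ (forall n, (1 <= n)%N -> (0 < w n)%N),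
      (forall m n, (1 <= m)%N -> (m < n)%N -> (w m < w n)%N)
    & exists N : nat, forall m : nat, (N <= m)%N ->
        exists i : 'I_k -> nat,
          (forall j, (1 <= i j)%N) /\ m = (\sum_(j < k) w (i j))%N].

(* X i stands for X_{i+1}, so this is X_1 + ... + X_n. *)
Definition partial_sum (T : Type) (X : nat -> T -> nat) (n : nat) (w : T)
    : nat :=
  (\sum_(i < n) X i w)%N.

(* Main.v *)
Require Import Defs.
From HB Require Import structures.
From mathcomp Require Import all_boot all_order all_algebra.
From mathcomp Require Import boolp zify lra.

(** Let [W_i] be the walk with gaps [X_2, X_3, ...]. Almost surely every large [m] is
of the form [W_i + W_j]: since the mean is finite, the maximal
ergodic inequality makes the gaps longer than some random [L] cover at most a quarter of
every initial segment, so half of the [t <= M] have both [t] and [M - t] within [L] of the walk,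
and some [M - d] with [d < 2 L] has a number of representations linear in [M].
Linearly many representations of [m] yield linearly many of [m + a] for each [a] in the
support, because each [W_i + W_j = m] with [j <= i] is followed by a gap [a] after [W_i]
independently with positive probability; this holds for all large [m] by an exponential
deviation bound and Borel-Cantelli. As the gcd is [1], finitely many such steps lead
from [M - d] to any prescribed large [m]. For [k >= 2] one then writes
[m = k X_1 + W_i + W_j + (k - 2) W_0], and [k = 1] contradicts [E X >= 1]. *)

Set Implicit Arguments.
Unset Strict Implicit.
Unset Printing Implicit Defensive.

Lemma leq_card_bigcup (I J : finType) (P : pred I) (F : I -> {set J}) (f : I -> nat) :
  (forall i, P i -> #|F i| <= f i) -> #|\bigcup_(i | P i) F i| <= \sum_(i | P i) f i.
Proof.
move=> h; elim/big_rec2: _ => [|i n A Pi IH]; first by rewrite cards0.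
by apply: leq_trans (leq_card_setU _ _) _; apply: leq_add => //; exact: h.
Qed.

Definition tail (L a : nat) : nat := a * (L < a).

(** * Walks, sums of two walk values, and reachable shifts *)

Section Walk.
Variable x : nat -> nat.

Definition walk (i : nat) : nat := \sum_(l < i) x l.

(* Requiring [j <= i] makes [rep m i] independent of the next gap [x i]. *)
Definition rep (m i : nat) : bool :=
  [exists j : 'I_i.+1, walk i + walk j == m].

(** With positive gaps [i <= walk i], so stopping at [i = m] loses no representation. *)
Definition nrep (m : nat) : nat := \sum_(i < m.+1) rep m i.

Definition linrep (H m : nat) : Prop := m <= H * nrep m.

(** The constant may worsen from [H] to [H']: only finitely many shifts get composed, and in this
    form the reachable shifts are closed under addition. *)
Definition reach (b : nat) : Prop :=
  forall H, exists H' M, forall m, M <= m -> linrep H m -> linrep H' (m + b).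

Lemma walkS i : walk i.+1 = walk i + x i.
Proof. by rewrite /walk big_ord_recr. Qed.

Lemma walk0 : walk 0 = 0. Proof. by rewrite /walk big_ord0. Qed.

Lemma reachD a b : reach a -> reach b -> reach (a + b).
Proof.
move=> ra rb H; have [H1 [M1 r1]] := ra H; have [H2 [M2 r2]] := rb H1.
exists H2, (maxn M1 M2) => m; rewrite geq_max => /andP[m1 m2] Hm.
by rewrite addnA; apply: r2; [exact: leq_trans m2 (leq_addr _ _) | exact: r1].
Qed.

Lemma reach0 : reach 0.
Proof. by move=> H; exists H, 0 => m _; rewrite addn0. Qed.

(** The final shift depends on [m] through a bounded offset, so one constant must serve a whole
    window of shifts; adding up constants and thresholds, one shift at a time, provides it. *)
Lemma reach_uniform B n : (forall b, B <= b -> reach b) ->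
  forall H, exists H' M, forall m b, M <= m -> B <= b < B + n -> linrep H m -> linrep H' (m + b).
Proof.
move=> rB H; elim: n => [|n [H1 [M1 IH]]].
  by exists 0, 0 => m b _; lia.
have [H2 [M2 r2]] := rB (B + n) (leq_addr _ _) H.
exists (H1 + H2), (M1 + M2) => m b Mm bn Hm; rewrite /linrep mulnDl.
have [bE|bN] := eqVneq b (B + n).
  rewrite bE; apply: leq_trans (r2 m _ Hm) (leq_addl _ _); lia.
apply: leq_trans (IH m b _ _ Hm) (leq_addr _ _); lia.
Qed.

Hypothesis x_gt0 : forall i, 0 < x i.

Lemma walk_ltn i j : i < j -> walk i < walk j.
Proof.
elim: j => // j IH; rewrite ltnS leq_eqVlt walkS => /orP[/eqP->|/IH]; have := x_gt0 j; lia.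
Qed.

Lemma walk_ge i : i <= walk i.
Proof. by elim: i => // i IH; rewrite walkS; have := x_gt0 i; lia. Qed.

Lemma walk_bracket t : exists i, [/\ i <= t, walk i <= t & t < walk i.+1].
Proof.
elim: t => [|t [i [it le lt]]]; first by exists 0; rewrite walkS walk0; split; rewrite ?x_gt0.
have [t1|t1] := leqP (walk i.+1) t.+1; last by exists i; split => //; lia.
exists i.+1; split=> //; rewrite (walkS i.+1); have := x_gt0 i.+1; lia.
Qed.

(** * An integer with linearly many representations just below every large [M] *)

Section Dense.
Variable L : nat.
Hypothesis tails : forall n, 4 * \sum_(i < n) tail L (x i) <= n.

Definition near_walk (M t : nat) : bool :=
  [exists i : 'I_M.+1, walk i <= t < walk i + L].

Lemma card_interval n a l : #|[set t : 'I_n | a <= t < a + l]| <= l.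
Proof.
elim: l => [|l IH]; first by rewrite eq_card0// => t; rewrite !inE; apply/negbTE; lia.
have -> : [set t : 'I_n | a <= t < a + l.+1] =
  [set t : 'I_n | a <= t < a + l] :|: [set t : 'I_n | t == a + l :> nat].
  by apply/setP=> t; rewrite !inE addnS ltnS; apply/idP/idP => ?; lia.
apply: leq_trans (leq_card_setU _ _) _; rewrite -addn1 leq_add//.
apply/card_le1_eqP => u v; rewrite !inE => /eqP uE /eqP vE.
by apply: val_inj; rewrite /= uE vE.
Qed.

(** An integer far from the walk lies between [walk i + L] and [walk i.+1] for some [i], hence in a
    gap longer than [L], and a gap contains no more integers than its length. *)
Lemma card_far M : 4 * #|[set t : 'I_M.+1 | ~~ near_walk M t]| <= M.+1.
Proof.
apply: leq_trans (tails M.+1); rewrite leq_mul2l/=.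
have sub : [set t : 'I_M.+1 | ~~ near_walk M t] \subset
  \bigcup_(i < M.+1) [set t : 'I_M.+1 | (L < x i) && (walk i <= t < walk i + x i)].
  apply/subsetP => t; rewrite inE negb_exists => /forallP h.
  have [i [it le lt]] := walk_bracket t.
  have iM : i < M.+1 by apply: leq_ltn_trans it (ltn_ord t).
  apply/bigcupP; exists (Ordinal iM) => //; rewrite inE/=.
  have := h (Ordinal iM); rewrite walkS in lt; rewrite /=; lia.
apply: leq_trans (subset_leq_card sub) _.
apply: leq_card_bigcup => i _; rewrite /tail; case: (L < x i) => /=.
  by rewrite muln1; exact: card_interval.
by rewrite eq_card0// => t; rewrite !inE.
Qed.

(** Double counting. If [walk i] and [walk j] lie just below [t] and [M - t], with offsets of sum
    [d < 2 * L], then [M - d = walk i + walk j]. At least half of all [t] arise in this way, too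
    many if [M - d] had few representations for every [d]. *)
Lemma nrep_dense M : 2 * L <= M ->
  exists2 d, d < 2 * L & linrep (8 * L ^ 2) (M - d).
Proof.
move=> LM.
pose D := [set t : 'I_M.+1 | near_walk M t && near_walk M (M - t)].
have cardD : M.+1 <= 2 * #|D|.
  have h1 := card_far M.
  pose F := [set t : 'I_M.+1 | ~~ near_walk M t].
  have : #|~: D| <= #|F| + #|F|.
    have -> : ~: D = F :|: (@rev_ord _) @^-1: F.
      by apply/setP => t; rewrite !inE/= negb_and subSS.
    apply: leq_trans (leq_card_setU _ _) _; rewrite leq_add2l.
    by rewrite on_card_preimset//; exact/onW_bij/inv_bij/rev_ordK.
  have := cardsC D; rewrite card_ord; rewrite -/F in h1; lia.
(* Here [i] is the larger of the two indices and [r] its offset. It may belong to [t] or to [M - t],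
   so a triple accounts for at most two values of [t]. *)
pose G (d : 'I_(2 * L)) (r : 'I_L) (i : 'I_(M - d).+1) :=
  [set t : 'I_M.+1 | rep (M - d) i &&
     (((t : nat) == walk i + r) || (M - t == walk i + r))].
have cardG d r i : #|G d r i| <= 2 * rep (M - d) i.
  rewrite /G; case: (rep (M - d) i) => /=; last by rewrite eq_card0// => t; rewrite !inE.
  have -> : [set t : 'I_M.+1 | ((t : nat) == walk i + r) || (M - t == walk i + r)] =
    [set t : 'I_M.+1 | (t : nat) == walk i + r] :|: [set t : 'I_M.+1 | M - t == walk i + r].
    by apply/setP => t; rewrite !inE.
  apply: leq_trans (leq_card_setU _ _) _; rewrite (leq_add (n1 := 1) (n2 := 1))//.
    apply/card_le1_eqP => u v; rewrite !inE => uE vE; apply: val_inj => /=; lia.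
  apply/card_le1_eqP => u v; rewrite !inE => uE vE; apply: val_inj => /=.
  have := ltn_ord u; have := ltn_ord v; lia.
have sub : D \subset \bigcup_d \bigcup_r \bigcup_i G d r i.
  have step (t : 'I_M.+1) (i j : nat) : walk i <= t < walk i + L ->
      walk j <= M - t < walk j + L -> j <= i -> exists d r l, t \in G d r l /\ rev_ord t \in G d r l.
    move=> it jt ji; have tM := ltn_ord t.
    have d2 : (t - walk i) + (M - t - walk j) < 2 * L by lia.
    have rL : t - walk i < L by lia.
    have iM : i < (M - Ordinal d2).+1 by rewrite /=; have := walk_ge i; lia.
    exists (Ordinal d2), (Ordinal rL), (Ordinal iM).
    have rp : rep (M - Ordinal d2) i.
      apply/existsP; exists (Ordinal (ji : j < i.+1)) => /=; lia.
    rewrite !inE/= rp/=; lia.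
  apply/subsetP => t; rewrite inE => /andP[/existsP[i it] /existsP[j jt]].
  have tM := ltn_ord t.
  suff [d [r [l h]]] : exists d r l, t \in G d r l.
    by apply/bigcupP; exists d => //; apply/bigcupP; exists r => //; apply/bigcupP; exists l.
  have [ji|/ltnW ij] := leqP j i.
    by have [d [r [l [h _]]]] := step t i j it jt ji; exists d, r, l.
  have [|||d [r [l [_ h]]]] := step (rev_ord t) j i; rewrite /= ?subSS ?subKn//.
  by exists d, r, l; rewrite rev_ordK in h.
have bound : #|D| <= \sum_(d < 2 * L) \sum_(r < L) 2 * nrep (M - d).
  apply: leq_trans (subset_leq_card sub) _.
  apply: leq_card_bigcup => d _; apply: leq_card_bigcup => r _.
  by rewrite /nrep big_distrr/=; apply: leq_card_bigcup => i _.
suff /existsP[d dP] : [exists d : 'I_(2 * L), M - d <= 8 * L ^ 2 * nrep (M - d)] by exists d.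
(* Otherwise the [2 * L * L] pairs of [d] and [r] cover at most [M / 2] points, whereas [D] has at
   least [(M + 1) / 2]. *)
apply: contraT; rewrite negb_exists => /forallP h.
have : 8 * L ^ 2 * \sum_(d < 2 * L) \sum_(r < L) 2 * nrep (M - d) <= 4 * L ^ 2 * M.
  rewrite big_distrr/=.
  apply: leq_trans (_ : \sum_(d < 2 * L) 2 * L * M <= _); last by rewrite sum_nat_const card_ord; lia.
  apply: leq_sum => d _; rewrite sum_nat_const card_ord.
  have := h d; rewrite -ltnNge; nia.
have L0 : 0 < L by case: (posnP L) bound => // L0; rewrite L0 big_ord0; lia.
nia.
Qed.
End Dense.
End Walk.

(** * Additive semigroups with gcd one, and the deterministic conclusion *)

Lemma gcd1_eventually_mem (S G : nat -> Prop) :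
  (forall e, (forall a, S a -> e %| a) -> e %| 1) ->
  (forall a, S a -> G a) -> G 0 -> (forall a b, G a -> G b -> G (a + b)) ->
  exists B, forall n, B <= n -> G n.
Proof.
move=> Sgcd SG G0 GD.
have GM q a : G a -> G (q * a).
  by move=> Ga; elim: q => [//|q IH]; rewrite mulSn; exact: GD.
have [[s [Ss s0]]|S0] := pselect (exists s, S s /\ 0 < s); last first.
  have := Sgcd 0; rewrite dvd0n => h; suff /eqP : 1 == 0 by []. 
  apply: h => a Sa; rewrite dvd0n; case: (posnP a) => [//|a0].
  by case: S0; exists a.
(* The least positive difference [d] of two members of [G] divides each [a] in [S], since [a %% d]
   is again a difference of two members; hence [d = 1]. *)
pose D d := `[< 0 < d /\ exists g, G g /\ G (g + d) >].
have exD : exists d, D d by exists s; apply/asboolP; split => //; exists 0; split=> //; exact: SG.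
case: (ex_minnP exD) => d /asboolP[d0 [g [Gg Ggd]]] dmin.
have d1 : d %| 1.
  apply: Sgcd => a Sa; rewrite /dvdn; case: (posnP (a %% d)) => [//|r0].
  have := ltn_pmod a d0; rewrite ltnNge => /negP[]; apply: dmin; apply/asboolP; split => //.
  exists (a %/ d * (g + d)); split; first exact: GM.
  have -> : a %/ d * (g + d) + a %% d = a + a %/ d * g.
    by rewrite {3}(divn_eq a d) mulnDr; lia.
  by apply: GD; [exact: SG|exact: GM].
move: d1 => /[!dvdn1] /eqP d1; rewrite {}d1 in Ggd.
(* Both [g] and [g + 1] lie in [G]. For [n >= g * g] the quotient by [g] exceeds the remainder,
   which is absorbed by turning [n %% g] copies of [g] into [g + 1]. *)
exists (g * g) => n gn.
case: (posnP g) => [g0|g0]; first by rewrite -(muln1 n); apply: GM; rewrite -[1]add0n -{1}g0.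
have h1 := ltn_pmod n g0; have h2 : g <= n %/ g by rewrite leq_divRL.
have -> : n = (n %/ g - n %% g) * g + n %% g * (g + 1).
  by rewrite {1}(divn_eq n g) mulnBl mulnDr muln1; have := leq_mul (ltnW (leq_trans h1 h2)) (leqnn g); lia.
by apply: GD; exact: GM.
Qed.

(** Starting from a well represented [M - d] with [M = m - B], the remaining shift [B + d] lies
    between [B] and [B + 2 * L], where all shifts are reachable with one common constant. *)
Lemma eventually_sum_of_two (x : nat -> nat) (L : nat) (S : nat -> Prop) :
  (forall i, 0 < x i) ->
  (forall n, 4 * \sum_(i < n) tail L (x i) <= n) ->
  (forall e, (forall a, S a -> e %| a) -> e %| 1) ->
  (forall a, S a -> reach x a) ->
  exists N, forall m, N <= m -> exists i j, m = walk x i + walk x j.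
Proof.
move=> x0 tails Sgcd Sreach.
have [B GB] := gcd1_eventually_mem Sgcd Sreach (@reach0 x) (@reachD x).
have [H [M0 h]] := reach_uniform (2 * L) GB (8 * L ^ 2).
exists (B + 2 * L + M0).+1 => m Nm.
have [|d dL dense] := nrep_dense x0 tails (M := m - B); first lia.
have := h (m - B - d) (B + d) _ _ dense.
have -> : m - B - d + (B + d) = m by lia.
rewrite /linrep => {}h.
have : 0 < nrep x m by have : m <= H * nrep x m by [apply: h; lia]; lia.
rewrite lt0n sum_nat_eq0 negb_forall => /existsP[i]; rewrite implyTb eqb0 negbK.
by move=> /existsP[j /eqP <-]; exists i, j.
Qed.

(** * Candidates, hits, and the excess of long gaps *)

Section Candidates.
Implicit Types x y : nat -> nat.

Definition ncand x m i n : nat := \sum_(i <= l < n) rep x m l.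

Definition nhit x m a i n : nat :=
  \sum_(i <= l < n) (rep x m l && (x l == a)).

Lemma eq_walk x y i : (forall l, (l < i) -> x l = y l) -> walk x i = walk y i.
Proof. by move=> xy; apply: eq_bigr => l _; exact: xy. Qed.

Lemma eq_rep x y m i : (forall l, (l < i) -> x l = y l) -> rep x m i = rep y m i.
Proof.
move=> xy; apply: eq_existsb => j; rewrite (eq_walk xy) (@eq_walk x y j)// => l lj.
by apply: xy; exact: leq_trans lj (ltn_ord j).
Qed.

Lemma eq_ncand x y m i n : (forall l, (l < n) -> x l = y l) ->
  ncand x m i n = ncand y m i n.
Proof.
move=> xy; apply: eq_big_nat => l /andP[_ ln]; rewrite (@eq_rep x y)// => l' l'l.
by apply: xy; exact: ltn_trans ln.
Qed.

Lemma eq_nhit x y m a i n : (forall l, (l < n) -> x l = y l) ->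
  nhit x m a i n = nhit y m a i n.
Proof.
move=> xy; apply: eq_big_nat => l /andP[_ ln]; rewrite xy// (@eq_rep x y)// => l' l'l.
by apply: xy; exact: ltn_trans ln.
Qed.

(** If [walk l + walk j = m] and the next gap is [a], then [walk l.+1 + walk j = m + a]. As [0 < a],
    the index [l.+1] stays within the range of [nrep]. *)
Lemma nhit_nrep x m a : (0 < a) -> (nhit x m a 0 m.+1 <= nrep x (m + a)).
Proof.
move=> a0; rewrite /nrep big_ord_recl addnC.
apply: leq_trans (leq_addr _ _).
rewrite /nhit big_mkord (big_ord_widen (m + a) (fun l => nat_of_bool (rep x m l && (x l == a)))); last lia.
rewrite big_mkcond/=; apply: leq_sum => l _; case: ifP => // _.
case: (boolP (rep x m l)) => //= /existsP[j /eqP jm]; case: eqP => //= xla.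
rewrite (_ : rep _ _ _)//; apply/existsP.
have jl : (j < (bump 0 l).+1) by rewrite /bump; have := ltn_ord j; lia.
exists (Ordinal jl) => /=; rewrite /bump/= add1n walkS; apply/eqP; lia.
Qed.

(* The maximum over [k <= n] of [e * \sum_(l < k) tail L (x l) - k], computed backwards. *)
Fixpoint excess e L n x : nat :=
  if n is n'.+1 then (e * tail L (x 0) + excess e L n' (x \o succn)).-1 else 0.

Lemma eq_excess e L n x y : (forall l, l < n -> x l = y l) ->
  excess e L n x = excess e L n y.
Proof.
elim: n x y => //= n IH x y xy; rewrite xy// (IH _ (y \o succn))// => l ln /=.
exact: xy.
Qed.

Lemma excess_leS e L n x : excess e L n x <= excess e L n.+1 x.
Proof.
elim: n x => // n IH x; have h := IH (x \o succn).
change ((e * tail L (x 0) + excess e L n (x \o succn)).-1 <=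
  (e * tail L (x 0) + excess e L n.+1 (x \o succn)).-1); lia.
Qed.

(** A positive excess means that the predecessor really subtracted [1]; integrated, this is the core
    of Garsia's argument. *)
Lemma excess_step e L n x :
  (0 < excess e L n.+1 x) + excess e L n.+1 x
    <= e * tail L (x 0) + excess e L n (x \o succn).
Proof. by rewrite /=; lia. Qed.

Lemma tail_sum_le_excess e L n x :
  e * \sum_(l < n) tail L (x l) <= n + excess e L n x.
Proof.
elim: n x => [|n IH] x; first by rewrite big_ord0 muln0.
rewrite big_ord_recl mulnDr [excess _ _ _ _]/= -[x ord0]/(x 0).
rewrite -[\sum_(i < n) _]/(\sum_(l < n) tail L ((x \o succn) l)).
by have := IH (x \o succn); lia.
Qed.
End Candidates.

(* Events determined by finitely many gaps *)
From mathcomp Require Import all_classical all_reals all_analysis measurable_realfun.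

Import Order.TTheory GRing.Theory Num.Theory numFieldNormedType.Exports.
Local Open Scope classical_set_scope.
Local Open Scope ring_scope.
Local Open Scope ereal_scope.

Definition adapted (i : nat) (Q : (nat -> nat) -> Prop) : Prop :=
  forall x y, (forall l, (l < i)%N -> x l = y l) -> Q x -> Q y.

Section Process.
Context d (T : measurableType d) (R : realType) (P : probability T R).
Implicit Types x : T -> nat -> nat.

Definition cylinder x (i : nat) (v : nat -> nat) : set T :=
  [set w | forall l, (l < i)%N -> x w l = v l].

Definition measurable_process x : Prop :=
  forall l (A : set nat), measurable [set w | A (x w l)].

Lemma measurable_cylinder x i v : measurable_process x -> measurable (cylinder x i v).
Proof.
move=> mx; rewrite (_ : cylinder x i v = \bigcap_(l in `I_i) [set w | [set v l] (x w l)]).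
  by apply: bigcap_measurableType => l _; exact: mx.
by apply/seteqP; split => w.
Qed.

(** [pickle] numbers the countably many words of length [i], and a word decides [Q]. The word [v]
    does not depend on the process, so two laws can be compared piece by piece. *)
Lemma adapted_piece i Q k : adapted i Q ->
  (forall x : T -> nat -> nat, [set w | Q (x w) /\ pickle (mkseq (x w) i) = k] = set0) \/
  exists v, forall x, [set w | Q (x w) /\ pickle (mkseq (x w) i) = k] = cylinder x i v.
Proof.
move=> aQ; have [[v [Qv vk]]|no] := pselect (exists v, Q v /\ pickle (mkseq v i) = k).
  right; exists v => x; apply/seteqP; split => w /=.
    move=> [_ wk] l li; have : mkseq (x w) i = mkseq v i.
      by apply: (pcan_inj pickleK); rewrite wk vk.
    by move/(congr1 (nth 0%N ^~ l)); rewrite !nth_mkseq.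
  move=> xv; split; first by apply: (aQ v) => // l /xv.
  rewrite -vk; congr pickle; apply/eq_in_map => l; rewrite mem_iota add0n => /andP[_].
  exact: xv.
left=> x; apply/seteqP; split => w //= -[Qx xk]; apply: no; exists (x w); split=> //.
Qed.

Lemma adapted_bigcup x i (Q : (nat -> nat) -> Prop) :
  [set w | Q (x w)] = \bigcup_k [set w | Q (x w) /\ pickle (mkseq (x w) i) = k].
Proof.
by apply/seteqP; split => [w Qx|w [k _ []]]//; exists (pickle (mkseq (x w) i)).
Qed.

Lemma measurable_piece x i Q k : measurable_process x -> adapted i Q ->
  measurable [set w | Q (x w) /\ pickle (mkseq (x w) i) = k].
Proof.
move=> mx aQ; have [->|[v ->]] := adapted_piece k aQ; first exact: measurable0.
exact: measurable_cylinder.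
Qed.

Lemma measurable_adapted x i Q : measurable_process x -> adapted i Q ->
  measurable [set w | Q (x w)].
Proof.
move=> mx aQ; rewrite (adapted_bigcup x i); apply: bigcupT_measurable => k.
exact: measurable_piece.
Qed.

(** Countable additivity over words. The events [D], [E] and the factor [c] let it cover both
    independence of the next gap and invariance under shifts. *)
Lemma law_adapted x y (D E : set T) (c : R) i Q :
  measurable_process x -> measurable_process y -> measurable D -> measurable E ->
  (0 <= c)%R ->
  (forall v, P (cylinder x i v `&` D) = c%:E * P (cylinder y i v `&` E)) ->
  adapted i Q ->
  P ([set w | Q (x w)] `&` D) = c%:E * P ([set w | Q (y w)] `&` E).
Proof.
move=> mx my mD mE c0 cyl aQ.
have series z F : measurable_process z -> measurable F ->
    P ([set w | Q (z w)] `&` F) =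
    \sum_(0 <= k <oo) P ([set w | Q (z w) /\ pickle (mkseq (z w) i) = k] `&` F).
  move=> mz mF; rewrite (adapted_bigcup z i) setI_bigcupl; apply: measure_semi_bigcup => //.
  - by move=> k; apply: measurableI => //; exact: measurable_piece.
  - by apply/trivIsetP => k l _ _ kl; apply/seteqP; split => w //= [[[_ wk] _] [[_ wl] _]];
      move: kl; rewrite -wk -wl eqxx.
  - apply: bigcupT_measurable => k; apply: measurableI => //; exact: measurable_piece.
rewrite !series// -nneseriesZl//; apply: eq_eseriesr => k _.
have [h|[v h]] := adapted_piece k aQ; rewrite !h; first by rewrite !set0I measure0 mule0.
exact: cyl.
Qed.
End Process.

(** * Independence and stationarity of the gaps *)

Section Iid.
Context d (T : measurableType d) (R : realType) (P : probability T R)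
  (X : nat -> {RV P >-> nat}).
Hypothesis X_indep : mutually_independent X.
Hypothesis X_ident : identically_distributed X.

Definition process (s : nat) (w : T) (l : nat) : nat := X (s + l)%N w.

Definition pmass (a : nat) : \bar R := P [set w | X 0%N w = a].

Lemma measurable_process_shift s : measurable_process (process s).
Proof.
move=> l A; rewrite -[X in measurable X]setTI.
exact: (@measurable_funPT _ _ _ _ (X (s + l)%N)).
Qed.

Lemma pmass_fin_num a : pmass a \is a fin_num.
Proof. by apply: fin_num_measure; exact: (measurable_process_shift 0%N 0%N [set a]). Qed.

Lemma pmass_le1 a : pmass a <= 1.
Proof. exact: (probability_le1 P (measurable_process_shift 0%N 0%N [set a])). Qed.

Lemma pmassE n a : P [set w | X n w = a] = pmass a.
Proof. by have := X_ident n 0%N (I : measurable [set a]). Qed.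

Lemma prob_cylinder s i v :
  P (cylinder (process s) i v) = \prod_(l <- iota 0 i) pmass (v l).
Proof.
have mB : forall l, measurable [set v (l - s)%N] by [].
have := X_indep (iota_uniq s i) mB.
rewrite (_ : [set w | _] = cylinder (process s) i v); last first.
  apply/seteqP; split => w /=.
    move=> h l li; rewrite /process h ?mem_iota; first by congr v; lia.
    lia.
  by move=> h l; rewrite mem_iota => sl; rewrite -h ?/process; [congr (X _ w)|]; lia.
move=> ->; have -> : iota s i = map (addn s) (iota 0 i) by rewrite -iotaDl addn0.
rewrite big_map.
by apply: eq_bigr => l _; rewrite addKn pmassE.
Qed.

Lemma prob_adapted_next i Q a : adapted i Q ->
  P ([set w | Q (process 0 w)] `&` [set w | X i w = a]) =
  pmass a * P [set w | Q (process 0 w)].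
Proof.
move=> aQ; have mX := measurable_process_shift.
have pf := pmass_fin_num a.
rewrite -(fineK pf) -[X in _ = _ * P X]setIT.
apply: (law_adapted (i := i)) => //; first exact: (mX 0%N i [set a]).
  exact/fine_ge0.
move=> v; rewrite setIT fineK//.
(* Appending [a] to the word [v] turns the joint event into a cylinder of length [i + 1]. *)
pose v' l := if (l < i)%N then v l else a.
transitivity (P (cylinder (process 0) i.+1 v')).
  congr (P _); apply/seteqP; split => w /=.
    move=> [h Xa] l; rewrite ltnS leq_eqVlt /v' => /orP[/eqP ->|li].
      by rewrite ltnn.
    by rewrite li h.
  move=> h; split; last by have := h i (ltnSn i); rewrite /v' ltnn.
  by move=> l li; rewrite h ?/v' ?li// ltnW.
rewrite !prob_cylinder -addn1 iotaD big_cat/= big_seq1 muleC /v' add0n ltnn.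
congr (_ * _); apply: eq_big_seq => l; rewrite mem_iota add0n => /andP[_ ->]//.
Qed.

Lemma prob_adapted_shift i Q s : adapted i Q ->
  P [set w | Q (process s w)] = P [set w | Q (process 0 w)].
Proof.
move=> aQ; have mX := measurable_process_shift.
rewrite -[X in P X = _]setIT -[X in _ = P X]setIT -[RHS]mul1e.
apply: (law_adapted (i := i)) => //.
by move=> v; rewrite !setIT mul1e !prob_cylinder.
Qed.
End Iid.

(** * Few hits among many candidates: an exponential bound *)

Section Adapted.
Implicit Types (x : nat -> nat) (Q S : (nat -> nat) -> Prop).

Lemma adaptedW i j Q : (i <= j)%N -> adapted i Q -> adapted j Q.
Proof. by move=> ij aQ x y xy; apply: aQ => l li; apply: xy; exact: leq_trans ij. Qed.

Lemma adapted_and i Q S : adapted i Q -> adapted i S ->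
  adapted i (fun x => Q x /\ S x).
Proof. by move=> aQ aS x y xy [Qx Sx]; split; [exact: aQ Qx|exact: aS Sx]. Qed.

Lemma adapted_not i Q : adapted i Q -> adapted i (fun x => ~ Q x).
Proof. by move=> aQ x y xy nQ Qy; apply/nQ/(aQ y) => // l li; rewrite xy. Qed.

End Adapted.

Section HitDeviation.
Context d (T : measurableType d) (R : realType) (P : probability T R)
  (X : nat -> {RV P >-> nat}).
Hypothesis X_indep : mutually_independent X.
Hypothesis X_ident : identically_distributed X.
Implicit Types Q S : (nat -> nat) -> Prop.

Definition pr Q : R := fine (P [set w | Q (process X 0 w)]).

Lemma prE i Q : adapted i Q -> P [set w | Q (process X 0 w)] = (pr Q)%:E.
Proof.
move=> aQ; rewrite fineK//; apply: fin_num_measure.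
exact: measurable_adapted (measurable_process_shift _ _) aQ.
Qed.

Lemma pr_ge0 Q : (0 <= pr Q)%R.
Proof. exact/fine_ge0. Qed.

Lemma pr_set0 Q : (forall x, ~ Q x) -> pr Q = 0%R.
Proof.
by move=> Q0; rewrite /pr (_ : [set _ | _] = set0) ?measure0//; apply/seteqP; split => w // /Q0.
Qed.

Lemma pr_le i Q S : adapted i Q -> adapted i S -> (forall x, Q x -> S x) ->
  (pr Q <= pr S)%R.
Proof.
move=> aQ aS QS; rewrite -lee_fin -(prE aQ) -(prE aS); have mX := measurable_process_shift X 0.
apply: le_measure; rewrite ?inE; [exact: measurable_adapted mX aQ|exact: measurable_adapted mX aS|].
by move=> w /QS.
Qed.

Lemma pr_split i Q S : adapted i Q -> adapted i S ->
  pr Q = (pr (fun x => Q x /\ S x) + pr (fun x => Q x /\ ~ S x))%R.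
Proof.
move=> aQ aS; have mX := measurable_process_shift X 0.
have aQS := adapted_and aQ aS; have aQnS := adapted_and aQ (adapted_not aS).
apply: EFin_inj; rewrite EFinD -(prE aQ) -(prE aQS) -(prE aQnS) -measureU.
- by congr (P _); apply/seteqP; split => w /=; [have := EM (S (process X 0 w)); tauto|tauto].
- exact: measurable_adapted mX aQS.
- exact: measurable_adapted mX aQnS.
- by apply/seteqP; split => w //= [[_ ?] []].
Qed.

Variable a : nat.
Let p : R := fine (pmass X a).

Lemma pr_next i Q : adapted i Q -> pr (fun x => Q x /\ x i = a) = (p * pr Q)%R.
Proof.
move=> aQ; have := prob_adapted_next X_indep X_ident a aQ.
by rewrite /pr /p => ->; rewrite fineM ?(prE aQ) ?pmass_fin_num.
Qed.

Lemma p_ge0 : (0 <= p)%R. Proof. exact/fine_ge0. Qed.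

Lemma p_le1 : (p <= 1)%R.
Proof.
by rewrite -lee_fin fineK ?pmass_le1// pmass_fin_num.
Qed.

(* Backward induction: among the candidates, [2 ^- nhit * (1 - p / 2) ^- ncand] is a martingale. *)
Lemma few_hits_le m k i Q al t : adapted i Q ->
  (pr (fun x => Q x /\ (al <= ncand x m i (i + k))%N /\ (nhit x m a i (i + k) < t)%N)
   <= pr Q * (2 ^+ t * (1 - p / 2) ^+ al))%R.
Proof.
have p0 := p_ge0; have p1 := p_le1.
have q0 : (0 <= 1 - p / 2)%R by lra.
have aE i' k' Q' al' t' : adapted i' Q' -> adapted (i' + k')
    (fun x => Q' x /\ (al' <= ncand x m i' (i' + k'))%N /\ (nhit x m a i' (i' + k') < t')%N).
  move=> aQ; apply: adapted_and; first exact: adaptedW (leq_addr _ _) aQ.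
  by move=> x y xy; rewrite (eq_ncand m i' xy) (eq_nhit m a i' xy).
have rhs0 Q' al' t' : (0 <= pr Q' * (2 ^+ t' * (1 - p / 2) ^+ al'))%R.
  by rewrite !mulr_ge0 ?exprn_ge0// pr_ge0.
have al0 k' i' Q' t' : adapted i' Q' ->
    (pr (fun x => Q' x /\ (0 <= ncand x m i' (i' + k'))%N /\ (nhit x m a i' (i' + k') < t'.+1)%N)
      <= pr Q' * (2 ^+ t'.+1 * (1 - p / 2) ^+ 0))%R.
  move=> aQ; apply: (@le_trans _ _ (pr Q')).
    apply: (pr_le (i := (i' + k')%N)); [exact: aE|exact: adaptedW (leq_addr _ _) aQ|by move=> x []].
  by rewrite expr0 mulr1 ler_peMr ?pr_ge0// exprn_ege1// ler1n.
(* With [t = 0] the event is empty, with [al = 0 < t] the bound is at least [pr Q], and with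
   [k = 0 < al] there are no candidates. *)
elim: k i Q al t => [|k IH] i Q [|al] [|t] aQ; do ?[exact: al0|by rewrite pr_set0// => x; lia].
  rewrite pr_set0// => x; rewrite /ncand addn0 big_geq//; lia.
pose r x := rep x m i.
have ar : adapted i r by move=> x y xy; rewrite /r (eq_rep m xy).
have aQr := adapted_and aQ ar; have aQnr := adapted_and aQ (adapted_not ar).
have ahit : adapted i.+1 (fun x => (x i = a)) by move=> x y xy; rewrite xy.
pose E x := Q x /\ (al < ncand x m i (i + k.+1))%N /\ (nhit x m a i (i + k.+1) < t.+1)%N.
have aEE : adapted (i + k.+1) E by exact: aE.
have ik : (i <= i + k.+1)%N by lia.
have ik1 : (i.+1 <= i + k.+1)%N by lia.
have ncE x : ncand x m i (i + k.+1) = (rep x m i + ncand x m i.+1 (i.+1 + k))%N.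
  by rewrite /ncand big_ltn ?addSnnS//; lia.
have nhE x : nhit x m a i (i + k.+1) =
    ((rep x m i && (x i == a)) + nhit x m a i.+1 (i.+1 + k))%N.
  by rewrite /nhit big_ltn ?addSnnS//; lia.
have aSS := adaptedW (leqnSn i).
(* Three cases for the index [i]: no candidate, a candidate that hits, a candidate that misses. Only
   a hit lowers [t]; either kind of candidate lowers [al]. *)
rewrite (pr_split aEE (adaptedW ik ar)).
rewrite (pr_split (adapted_and aEE (adaptedW ik ar)) (adaptedW ik1 ahit)).
have E0 : (pr (fun x => E x /\ ~ r x) <=
    pr (fun x => Q x /\ ~ r x) * (2 ^+ t.+1 * (1 - p / 2) ^+ al.+1))%R.
  apply: le_trans (IH i.+1 _ al.+1 t.+1 (aSS _ aQnr)); apply: (pr_le (i := (i + k.+1)%N)).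
  - exact: adapted_and aEE (adapted_not (adaptedW ik ar)).
  - by rewrite -addSnnS; apply: aE; exact: aSS.
  - move=> x [[Qx []]]; rewrite ncE nhE => h1 h2 rx.
    have rf : rep x m i = false by apply/negbTE/negP.
    by move: h1 h2; rewrite rf /= !add0n.
have E1 : (pr (fun x => (E x /\ r x) /\ x i = a) <=
    p * pr (fun x => Q x /\ r x) * (2 ^+ t * (1 - p / 2) ^+ al))%R.
  rewrite -(pr_next aQr).
  apply: le_trans (IH i.+1 _ al t (adapted_and (aSS _ aQr) ahit)).
  apply: (pr_le (i := (i + k.+1)%N)).
  - by apply: adapted_and (adaptedW ik1 ahit); apply: adapted_and => //; exact: adaptedW ar.
  - by rewrite -addSnnS; apply: aE; apply: adapted_and ahit; exact: aSS.
  - move=> x [[[Qx []]]]; rewrite ncE nhE /r => h1 h2 rx xa.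
    by move: h1 h2; rewrite rx xa eqxx/= !add1n !ltnS.
have E2 : (pr (fun x => (E x /\ r x) /\ x i <> a) <=
    (1 - p) * pr (fun x => Q x /\ r x) * (2 ^+ t.+1 * (1 - p / 2) ^+ al))%R.
  have -> : ((1 - p) * pr (fun x => Q x /\ r x) = pr (fun x => (Q x /\ r x) /\ x i <> a))%R.
    by rewrite mulrBl mul1r -(pr_next aQr) (pr_split (aSS _ aQr) ahit) addrAC subrr add0r.
  apply: le_trans (IH i.+1 _ al t.+1 (adapted_and (aSS _ aQr) (adapted_not ahit))).
  apply: (pr_le (i := (i + k.+1)%N)).
  - by apply: adapted_and (adapted_not (adaptedW ik1 ahit)); apply: adapted_and => //; exact: adaptedW ar.
  - by rewrite -addSnnS; apply: aE; apply: adapted_and (adapted_not ahit); exact: aSS.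
  - move=> x [[[Qx []]]]; rewrite ncE nhE /r => h1 h2 rx xa.
    move: h1 h2; rewrite rx add1n ltnS => h1 h2; split => //; split=> //.
    by apply: leq_ltn_trans h2; exact: leq_addl.
rewrite (pr_split aQ ar).
(* The two candidate cases combine through [p + 2 * (1 - p) = 2 * (1 - p / 2)]. *)
apply: le_trans (lerD (lerD E1 E2) E0) _; rewrite !exprS; lra.
Qed.
End HitDeviation.

(** * Almost sure reachability by Borel-Cantelli *)

Lemma expr_le_quarter (R : realType) (q : R) : (0 <= q < 1)%R ->
  exists h, (q ^+ h <= 4^-1)%R.
Proof.
move=> /andP[q0 q1]; have /cvgr0Pnorm_le : GRing.exp q @ \oo --> (0 : R)%R.
  by apply: cvg_expr; rewrite ger0_norm.
move=> /(_ 4^-1%R); rewrite invr_gt0 ltr0n => /(_ isT)[h _ /(_ h (leqnn h))] /= qh.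
by exists h; rewrite ger0_norm ?exprn_ge0 in qh.
Qed.

(** The terms are constant on blocks of length [K] and halve from one block to the next; the closed
    form shows that partial sums are at most [2 * K]. *)
Lemma sum_half_divn (R : realFieldType) (K n : nat) : (0 < K)%N ->
  (\sum_(0 <= m < n) (2^-1 : R) ^+ (m %/ K) =
   2 * K%:R - 2^-1 ^+ (n %/ K) * (2 * K%:R - (n %% K)%:R))%R.
Proof.
move=> K0; elim: n => [|n IH].
  by rewrite big_geq// div0n mod0n expr0; lra.
rewrite big_nat_recr//= IH divnS// modnS; case: ifP => [Kn|_] /=.
  have rK : (n %% K).+1 = K.
    apply/eqP; rewrite eqn_leq ltn_pmod//= dvdn_leq//.
    by move: Kn; rewrite {1}(divn_eq n K) -addnS dvdn_addr// dvdn_mull.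
  rewrite add1n exprS; have -> : (n %% K)%:R = (K%:R - 1 : R)%R by rewrite -{2}rK -addn1 natrD addrK.
  by rewrite subr0; lra.
by rewrite add0n -addn1 natrD; lra.
Qed.

Section Reach.
Context d (T : measurableType d) (R : realType) (P : probability T R)
  (X : nat -> {RV P >-> nat}).
Hypothesis X_indep : mutually_independent X.
Hypothesis X_ident : identically_distributed X.
Variable a : nat.
Hypothesis a_gt0 : (0 < a)%N.
Hypothesis mass_gt0 : 0 < pmass X a.

Lemma ae_reach : {ae P, forall w, reach (process X 0 w) a}.
Proof.
have p0 : (0 < fine (pmass X a))%R by rewrite -lte_fin fineK ?pmass_fin_num.
have p1 := p_le1 X a.
(* With [h] candidates per allowed hit, each allowed hit contributes a factor of at most
   [2 * 4^-1 = 2^-1] to the deviation bound. *)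
have [h qh] : exists h, ((1 - fine (pmass X a) / 2) ^+ h <= 4^-1)%R.
  by apply: expr_le_quarter; lra.
have h0 : (0 < h)%N by rewrite lt0n; apply/eqP => h0; move: qh; rewrite h0 expr0; lra.
pose bad K m x := (h * (m %/ K) <= ncand x m 0 (0 + m.+1))%N /\
  (nhit x m a 0 (0 + m.+1) < m %/ K)%N.
have abad K m : adapted m.+1 (bad K m).
  by move=> x y xy; rewrite /bad (eq_ncand m 0 xy) (eq_nhit m a 0 xy).
have Pbad K m : P [set w | bad K m (process X 0 w)] <= (2^-1 ^+ (m %/ K))%:E.
  rewrite (prE X (abad K m)) lee_fin.
  have aT : adapted 0 (fun=> True) by [].
  have := few_hits_le X_indep X_ident a m m.+1 (h * (m %/ K)) (m %/ K) aT.
  have -> : pr X (fun=> True) = 1%R.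
    by rewrite /pr (_ : [set _ | _] = setT) ?probability_setT//; apply/seteqP; split.
  have -> : (fun x => True /\ (h * (m %/ K) <= ncand x m 0 (0 + m.+1))%N /\
      (nhit x m a 0 (0 + m.+1) < m %/ K)%N) = bad K m.
    by apply/funext => x; apply/propext; rewrite /bad; tauto.
  move/le_trans; apply; rewrite mul1r exprM -exprMn lerXn2r ?nnegrE//; try lra.
  by rewrite mulr_ge0// exprn_ge0//; lra.
have io K : (0 < K)%N -> {ae P, forall w, exists M, forall m, (M <= m)%N -> ~ bad K m (process X 0 w)}.
  move=> K0; pose F m := [set w | bad K m (process X 0 w)].
  have mF m : measurable (F m) by apply: measurable_adapted (abad K m); exact: measurable_process_shift.
  have /negligibleP : P (lim_sup_set F) = 0.
    apply: lim_sup_set_cvg0 => //; apply: (@le_lt_trans _ _ (2 * K%:R)%:E); last exact: ltry.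
    apply: lime_le; first exact: is_cvg_nneseries.
    apply: nearW => n; apply: (@le_trans _ _ (\sum_(0 <= m < n) (2^-1 ^+ (m %/ K))%:E)).
      by apply: lee_sum => m _; exact: Pbad.
    rewrite sumEFin lee_fin sum_half_divn// gerBl mulr_ge0 ?exprn_ge0// subr_ge0.
    by rewrite -natrM ler_nat; have := ltn_pmod n K0; lia.
  move=> null; apply: negligibleS (null _); last first.
    by apply: bigcap_measurable => // n _; apply: bigcup_measurable.
  move=> w /= no n _; apply: contrapT => nF; apply: no; exists n => m nm badm.
  by apply: nF; exists m.
(* If [m <= H * nrep m], then [m] has at least [h * (m %/ K)] candidates for [K = h * H.+1]; the
   successor keeps [K] positive when [H = 0]. *)
have : {ae P, forall w, forall H, exists M, forall m, (M <= m)%N ->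
    ~ bad (h * H.+1)%N m (process X 0 w)}.
  by apply: ae_foralln => H; apply: io; rewrite muln_gt0 h0.
apply: filterS => w good H; have [M gM] := good H.
set K := (h * H.+1)%N in gM; have K0 : (0 < K)%N by rewrite muln_gt0 h0.
(* From [K + a <= m] follow [m < 2 * K * (m %/ K)] and [a <= m], whence the factor [4] for
   [m + a]. *)
exists (4 * K)%N, (M + K + a)%N => m Mm; rewrite /linrep => lin.
have Mm' : (M <= m)%N by lia.
have := gM m Mm'; rewrite /bad !add0n => nbad.
have lo := leq_trunc_div m K; have hi := ltn_ceil m K0.
have cand : (h * (m %/ K) <= ncand (process X 0 w) m 0 m.+1)%N.
  rewrite /ncand big_mkord -/(nrep _ _) -(leq_pmul2l (ltn0Sn H)).
  apply: leq_trans (_ : m <= _)%N; first by rewrite mulnA (mulnC _ h) mulnC.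
  by apply: leq_trans lin _; rewrite leq_mul2r leqnSn orbT.
have hit : (m %/ K <= nhit (process X 0 w) m a 0 m.+1)%N.
  by rewrite leqNgt; apply/negP => lt; exact: nbad.
have := leq_trans hit (nhit_nrep _ _ a_gt0).
move=> tn; apply: leq_trans (leq_mul (leqnn (4 * K)) tn).
have t1 : (1 <= m %/ K)%N by rewrite divn_gt0//; lia.
by move: hi lo t1; move: (m %/ K)%N => t; nia.
Qed.
End Reach.

(** * Expectations of natural-valued variables *)

Section NatExpectation.
Context d (T : measurableType d) (R : realType) (P : probability T R).
Implicit Types f g : T -> nat.

Definition nat_expect f : \bar R := \int[P]_w ((f w)%:R)%:E.

Definition measurable_nat f : Prop := forall A : set nat, measurable [set w | A (f w)].

Lemma measurable_fun_nat f : measurable_nat f ->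
  measurable_fun setT (fun w => ((f w)%:R : R)%:E).
Proof.
move=> mf; have mf' : measurable_fun setT f.
  by move=> _ A _; rewrite setTI; exact: mf.
have mn : measurable_fun setT (fun n : nat => (n%:R : R)%:E) by [].
exact: measurableT_comp mn mf'.
Qed.

(** Both sides are integrals over [nat] against the image laws, which the hypothesis identifies. *)
Lemma eq_nat_expect f g : measurable_nat f -> measurable_nat g ->
  (forall A : set nat, P [set w | A (f w)] = P [set w | A (g w)]) ->
  nat_expect f = nat_expect g.
Proof.
move=> mf mg fg.
have mfun h : measurable_nat h -> measurable_fun setT h.
  by move=> mh _ A _; rewrite setTI; exact: mh.
have mn : measurable_fun setT (fun n : nat => (n%:R : R)%:E) by [].
have push h (mh : measurable_nat h) :
    nat_expect h = \int[pushforward P h]_n (n%:R)%:E.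
  by apply/esym; apply: (ge0_integral_pushforward (mfun _ mh) P measurableT mn) => n _; rewrite lee_fin.
rewrite (push f mf) (push g mg).
by congr (integral _ _ _); apply/funext => A; exact: fg.
Qed.

Lemma nat_expect_ge0 f : 0 <= nat_expect f.
Proof. by apply: integral_ge0 => w _; rewrite lee_fin. Qed.

Lemma nat_expect_le f g : measurable_nat f -> measurable_nat g ->
  (forall w, (f w <= g w)%N) -> nat_expect f <= nat_expect g.
Proof.
move=> mf mg fg; by apply: ge0_le_integral => //; do ?[exact: measurable_fun_nat | by move=> w _; rewrite lee_fin ?ler_nat ?ler0n].
Qed.

Lemma nat_expectD f g : measurable_nat f -> measurable_nat g ->
  nat_expect (fun w => f w + g w)%N = nat_expect f + nat_expect g.
Proof.
move=> mf mg; rewrite /nat_expect -ge0_integralD//; do ?[exact: measurable_fun_nat].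
by apply: eq_integral => w _; rewrite natrD EFinD.
Qed.

Lemma nat_expectZ e f : measurable_nat f ->
  nat_expect (fun w => e * f w)%N = e%:R%:E * nat_expect f.
Proof.
move=> mf; rewrite /nat_expect -ge0_integralZl//; do ?[exact: measurable_fun_nat].
by apply: eq_integral => w _; rewrite natrM EFinM.
Qed.

Lemma nat_expect_bool (b : T -> bool) : measurable [set w | b w] ->
  nat_expect (fun w => b w) = P [set w | b w].
Proof.
move=> mb; rewrite -[X in P X]setIT -(integral_indic _ measurableT mb).
apply: eq_integral => w _; congr EFin; rewrite indicE; case: (boolP (b w)) => bw.
  by rewrite mem_set.
by rewrite memNset//; apply/negP.
Qed.
End NatExpectation.

(** * The maximal inequality and the share of long gaps *)

Section Tails.
Context d (T : measurableType d) (R : realType) (P : probability T R)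
  (X : nat -> {RV P >-> nat}).
Hypothesis X_indep : mutually_independent X.
Hypothesis X_ident : identically_distributed X.

Let tail_mean L := nat_expect P (fun w => tail L (X 0%N w)).

Lemma processS s w : process X s.+1 w = process X s w \o succn.
Proof. by apply/funext => l /=; rewrite /process addSnnS. Qed.

Lemma measurable_nat_excess e L n s :
  measurable_nat (fun w => excess e L n (process X s w)).
Proof.
move=> A; apply: (measurable_adapted (i := n) (Q := fun x => A (excess e L n x))).
  exact: measurable_process_shift.
by move=> x y xy; rewrite (eq_excess e L xy).
Qed.

Lemma measurable_nat_tail L : measurable_nat (fun w => tail L (X 0%N w)).
Proof. by move=> A; exact: (measurable_process_shift X 0%N 0%N (fun n => A (tail L n))). Qed.

Lemma expect_excess_shift e L n s :
  nat_expect P (fun w => excess e L n (process X s w)) =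
  nat_expect P (fun w => excess e L n (process X 0 w)).
Proof.
apply: eq_nat_expect; try exact: measurable_nat_excess.
move=> A; apply: (prob_adapted_shift X_indep X_ident (i := n) (Q := fun x => A (excess e L n x))).
by move=> x y xy; rewrite (eq_excess e L xy).
Qed.

Lemma measurable_natD (f g : T -> nat) : measurable_nat f -> measurable_nat g ->
  measurable_nat (fun w => f w + g w)%N.
Proof.
move=> mf mg A.
rewrite (_ : [set w | _] = \bigcup_k ([set w | [set k] (f w)] `&` [set w | [set l | A (k + l)%N] (g w)])).
  by apply: bigcupT_measurable => k; apply: measurableI; [exact: mf|exact: mg].
apply/seteqP; split => [w Aw|w [k _ [/= <-]]]//.
by exists (f w).
Qed.

Lemma measurable_natZ e (f : T -> nat) : measurable_nat f ->
  measurable_nat (fun w => e * f w)%N.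
Proof. by move=> mf A; exact: (mf (fun n => A (e * n)%N)). Qed.

Lemma expect_excess_step e L n :
  P [set w | (0 < excess e L n.+1 (process X 0 w))%N] +
    nat_expect P (fun w => excess e L n.+1 (process X 0 w)) <=
  e%:R%:E * tail_mean L + nat_expect P (fun w => excess e L n (process X 0 w)).
Proof.
have mpos : measurable [set w | (0 < excess e L n.+1 (process X 0 w))%N].
  exact: (measurable_nat_excess e L n.+1 0 (fun k => (0 < k)%N)).
have mpos' : measurable_nat (fun w => (0 < excess e L n.+1 (process X 0 w))%N : nat).
  move=> A; exact: (measurable_nat_excess e L n.+1 0 (fun k => A ((0 < k)%N : nat))).
rewrite -nat_expect_bool// -nat_expectD//; last exact: measurable_nat_excess.
rewrite -(expect_excess_shift e L n 1) -nat_expectZ; last exact: measurable_nat_tail.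
rewrite -nat_expectD; [|exact/measurable_natZ/measurable_nat_tail|exact: measurable_nat_excess].
apply: nat_expect_le => [||w].
- by apply: measurable_natD => //; exact: measurable_nat_excess.
- by apply: measurable_natD; [exact/measurable_natZ/measurable_nat_tail|exact: measurable_nat_excess].
- by rewrite processS; exact: excess_step.
Qed.

(** Finiteness allows expected excesses to be cancelled from an inequality between extended
    reals. *)
Lemma expect_excess_fin e L n : tail_mean L < +oo ->
  nat_expect P (fun w => excess e L n (process X 0 w)) < +oo.
Proof.
move=> Loo; elim: n => [|n IH].
  by rewrite /nat_expect/= integral0_eq ?ltry.
apply: le_lt_trans (_ : _ <= P [set w | (0 < excess e L n.+1 (process X 0 w))%N] +
    nat_expect P (fun w => excess e L n.+1 (process X 0 w))) _.
  by rewrite leeDr.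
apply: le_lt_trans (expect_excess_step e L n) _.
by rewrite lte_add_pinfty// lte_mul_pinfty// lee_fin.
Qed.

(* The maximal ergodic inequality, by Garsia's argument. *)
Lemma prob_excess_le e L n : tail_mean L < +oo ->
  P [set w | (0 < excess e L n (process X 0 w))%N] <= e%:R%:E * tail_mean L.
Proof.
move=> Loo; set E := fun n => nat_expect P (fun w => excess e L n (process X 0 w)).
have Efin k : E k \is a fin_num by rewrite ge0_fin_numE ?expect_excess_fin// nat_expect_ge0.
have leS : P [set w | (0 < excess e L n (process X 0 w))%N] <=
    P [set w | (0 < excess e L n.+1 (process X 0 w))%N].
  apply: le_measure; rewrite ?inE; try exact: (measurable_nat_excess e L _ 0 (fun k => (0 < k)%N)).
  by move=> w /= /leq_trans; apply; exact: excess_leS.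
(* Once [E n.+1] is added on both sides, the integrated step inequality applies, and [E n <= E n.+1]
   gives the rest. *)
apply: le_trans leS _; rewrite -(leeD2rE _ _ (Efin n.+1)).
apply: le_trans (expect_excess_step e L n) _; rewrite leeD2l//.
apply: nat_expect_le; try exact: measurable_nat_excess.
by move=> w; exact: excess_leS.
Qed.

Hypothesis X_mean : nat_expect P (X 0%N) < +oo.

Lemma measurable_nat_X0 : measurable_nat (X 0%N).
Proof. by move=> A; exact: (measurable_process_shift X 0%N 0%N A). Qed.

Lemma tail_mean_fin L : tail_mean L < +oo.
Proof.
apply: le_lt_trans X_mean; apply: nat_expect_le => [||w].
- exact: measurable_nat_tail.
- exact: measurable_nat_X0.
- by rewrite /tail; case: (_ < _)%N; rewrite ?muln1 ?muln0.
Qed.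

(** Dominated convergence: [tail L a] vanishes once [a <= L], and the integrable gap itself
    dominates. *)
Lemma tail_mean_cvg0 : tail_mean L @[L --> \oo] --> 0.
Proof.
rewrite (_ : 0 = \int[P]_w (cst 0 w)); last by rewrite integral0.
apply: (@dominated_cvg _ _ _ P setT measurableT _ _ (fun w => (X 0%N w)%:R%:E)) => //.
- move=> L; apply: measurable_fun_nat; exact: measurable_nat_tail.
- move=> w _; apply: cvg_near_cst; exists (X 0%N w) => // L /= wL.
  by rewrite /tail ltnNge wL muln0.
- apply/integrableP; split; first exact/measurable_fun_nat/measurable_nat_X0.
  apply: le_lt_trans X_mean; rewrite le_eqVlt; apply/orP; left; apply/eqP.
  by apply: eq_integral => w _; rewrite gee0_abs// lee_fin.
- move=> L w _; rewrite gee0_abs ?lee_fin// ler_nat /tail.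
  by case: (_ < _)%N; rewrite ?muln1 ?muln0.
Qed.

(** By the maximal inequality and continuity from below in [n], failure for all [L] at once has
    probability at most [e * tail_mean L] for each [L], and this tends to [0]. *)
Lemma ae_tails e : {ae P, forall w, exists L, forall n,
  (e * \sum_(l < n) tail L (process X 0 w l) <= n)%N}.
Proof.
pose F L n := [set w | (0 < excess e L n (process X 0 w))%N].
have mF L n : measurable (F L n) by exact: (measurable_nat_excess e L n 0 (fun k => (0 < k)%N)).
pose B := \bigcap_L \bigcup_n F L n.
have mU L : measurable (\bigcup_n F L n) by exact: bigcupT_measurable.
have mB : measurable B by exact: bigcapT_measurable.
have PU L : P (\bigcup_n F L n) <= e%:R%:E * tail_mean L.
  have ndF : nondecreasing_seq (F L).
    apply/nondecreasing_seqP => n; apply/subsetPset => w /= /leq_trans; apply; exact: excess_leS.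
  have cv := nondecreasing_cvg_mu (mu := P) (mF L) (mU L) ndF.
  rewrite -(cvg_lim _ cv)//; apply: lime_le; first by apply/cvg_ex; eexists; exact: cv.
  by apply: nearW => n; apply: prob_excess_le; exact: tail_mean_fin.
have : P.-negligible B.
  apply/negligibleP => //; apply/eqP; rewrite eq_le measure_ge0 andbT.
  have cv : e%:R%:E * tail_mean L @[L --> \oo] --> e%:R%:E * 0.
    by apply: cvgeZl => //; exact: tail_mean_cvg0.
  rewrite mule0 in cv; rewrite -(cvg_lim _ cv)//.
  apply: lime_ge; first by apply/cvg_ex; eexists; exact: cv.
  apply: nearW => L; apply: le_trans (PU L); apply: le_measure; rewrite ?inE//.
  by move=> w; apply.
apply: negligibleS => w /= bad L _; apply: contrapT => no; apply: bad; exists L => n.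
have := tail_sum_le_excess e L n (process X 0 w).
suff -> : excess e L n (process X 0 w) = 0%N by rewrite addn0.
by apply/eqP; rewrite -leqn0 leqNgt; apply/negP => h; apply: no; exists n.
Qed.
End Tails.

(** * Dropping the first gap, and the final assembly *)

Section Shift.
Context d (T : measurableType d) (R : realType) (P : probability T R)
  (X : nat -> {RV P >-> nat}).

(** [walk] includes the value [0] at index [0], which is not an admissible summand. With [X_1] as a
    common offset, index [0] of the shifted walk corresponds to [W_1]. *)
Definition shift_seq (n : nat) : {RV P >-> nat} := X n.+1.

Lemma shift_indep : mutually_independent X -> mutually_independent shift_seq.
Proof.
move=> X_indep J B uJ mB.
have := X_indep (map succn J) (fun n => B n.-1) _ (fun n => mB n.-1).
rewrite (map_inj_uniq succn_inj) big_map => /(_ uJ) <-; congr (P _).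
apply/seteqP; split => w /= h i.
  by move=> /mapP[j jJ ->]; exact: h.
by move=> iJ; exact: (h i.+1 (map_f _ iJ)).
Qed.

Lemma shift_ident : identically_distributed X -> identically_distributed shift_seq.
Proof. by move=> X_ident i j B mB; exact: X_ident. Qed.

Lemma pmass_shift a : identically_distributed X -> pmass shift_seq a = pmass X a.
Proof. by move=> X_ident; exact: (pmassE X_ident 1%N). Qed.

Lemma expect_shift : identically_distributed X ->
  nat_expect P (shift_seq 0%N) = nat_expect P (X 0%N).
Proof.
move=> X_ident; apply: eq_nat_expect; try exact: measurable_nat_X0.
by move=> A; exact: (X_ident 1%N 0%N A).
Qed.

Lemma expect_ge1 (f : T -> nat) : measurable_nat f -> (forall w, (0 < f w)%N) ->
  1 <= nat_expect P f.
Proof.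
move=> mf f0; rewrite -(@probability_setT _ _ _ P).
rewrite (_ : P setT = nat_expect P (fun w => true)); last first.
  rewrite (nat_expect_bool P (b := fun=> true)).
    by congr (P _); apply/seteqP; split.
  by rewrite (_ : [set _ | _] = setT)//; apply/seteqP; split.
by apply: nat_expect_le => // A; have [At|nA] := pselect (A 1%N);
  [rewrite (_ : [set _ | _] = setT)|rewrite (_ : [set _ | _] = set0)] => //;
  apply/seteqP; split.
Qed.
End Shift.

Lemma weakly_complete_of_shift (k : nat) (x : nat -> nat) :
  (forall l, (0 < x l)%N) ->
  (exists N, forall m, (N <= m)%N ->
     exists i j, m = (walk (x \o succn) i + walk (x \o succn) j)%N) ->
  weakly_asymptotically_complete k.+2 (walk x).
Proof.
move=> x0 [N hN]; split => [n n0|m n _ mn|]; first exact: leq_trans n0 (walk_ge x0 n).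
  exact: walk_ltn.
have walk1 n : walk x n.+1 = (x 0 + walk (x \o succn) n)%N.
  by rewrite /walk big_ord_recl.
exists (N + k.+2 * x 0)%N => m Nm.
have [|i [j mij]] := hN (m - k.+2 * x 0)%N; first lia.
(* Two summands use [i] and [j], the other [k] are [walk x 1 = x 0]. The outer successor adds one
   [x 0] to each shifted value and keeps every index positive. *)
exists (fun l : 'I_k.+2 => (if val l == 0 then i else if val l == 1 then j else 0).+1)%N.
split => //; rewrite 2!big_ord_recl/= !walk1.
by rewrite walk0 addn0 sum_nat_const card_ord; lia.
Qed.

Theorem theorem1p4 (k : nat) (k_gt0 : (0 < k)%N)
    (d : measure_display) (T : measurableType d) (R : realType)
    (P : probability T R) (X : nat -> {RV P >-> nat})
    (X_pos : forall (n : nat) (w : T), (0 < X n w)%N)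
    (X_indep : mutually_independent X)
    (X_ident : identically_distributed X)
    (X_gcd : is_gcd_of (Supp (X 0%N)) 1)
    (X_mean : 'E_P[fun w : T => (X 0%N w)%:R : R] < k%:R%:E) :
  {ae P, forall w : T,
    weakly_asymptotically_complete k (fun n : nat => partial_sum (fun i => X i) n w)}.
Proof.
have E_lt : nat_expect P (X 0%N) < k%:R%:E by move: X_mean; rewrite unlock.
case: k k_gt0 X_mean E_lt => [//|[|k]] _ _ E_lt.
  have := expect_ge1 P (measurable_nat_X0 X) (X_pos 0%N).
  by rewrite leNgt E_lt.
pose Y := shift_seq X.
have Y_indep : mutually_independent Y by exact: shift_indep.
have Y_ident : identically_distributed Y by exact: shift_ident.
(* The factor [4] keeps at most a quarter of each initial segment far from the walk, as
   [eventually_sum_of_two] demands. *)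
have tails := ae_tails Y_indep Y_ident
  (eq_ind_r (fun e => e < +oo) (lt_trans E_lt (ltry _)) (expect_shift X_ident)) 4.
have reachable : {ae P, forall w, forall a, Supp (X 0%N) a -> reach (process Y 0 w) a}.
  apply: ae_foralln => a; have [Sa|nSa] := pselect (Supp (X 0%N) a); last exact: aeW.
  have a0 : (0 < a)%N.
    rewrite lt0n; apply/eqP => a0; move: Sa; rewrite /Supp /= a0.
    rewrite (_ : [set _ | _] = set0) ?measure0 ?ltxx//.
    by apply/seteqP; split => w //= Xw; have := X_pos 0%N w; rewrite Xw.
  have Ya : 0 < pmass Y a by rewrite pmass_shift.
  by apply: filterS (ae_reach Y_indep Y_ident a0 Ya) => w.
apply: filterS2 tails reachable => w [L tailsL] reachable.
apply: (@weakly_complete_of_shift k (fun i => X i w)) => //.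
have Y0 l : (0 < process Y 0 w l)%N by exact: X_pos.
have [N hN] := eventually_sum_of_two Y0 tailsL X_gcd.2 reachable.
by exists N.
Qed.
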